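(* (Fundamental theorem of $(p,q)$-calculus) If $F(x)$ is a $(p,q)$-antiderivative of $f(x)$, i.e. $D_{p,q}F(x)=f(x)$, and $F(x)$ is continuous at $x=0$, then $$\int_a^b f(x)\,d_{p,q}x=F(b)-F(a),$$ where $0\leq a<b\leq\infty$.
   Context: Here $p\neq q$ are numbers to which the definitions below apply. The $(p,q)$-derivative is $D_{p,q}F(x)=\dfrac{F(px)-F(qx)}{(p-q)x}$ for $x\neq0$, and $(D_{p,q}F)(0)=F'(0)$ provided $F$ is differentiable at $0$. For a real number $a$, the definite $(p,q)$-integral is $$\int_0^a f(x)\,d_{p,q}x=(q-p)a\sum_{k=0}^\infty \frac{p^k}{q^{k+1}}f\left(\frac{p^k}{q^{k+1}}a\right)\ \text{ if } \left|\frac pq\right|<1,\qquad \int_0^a f(x)\,d_{p,q}x=(p-q)a\sum_{k=0}^\infty \frac{q^k}{p^{k+1}}f\left(\frac{q^k}{p^{k+1}}a\right)\ \text{ if } \left|\frac pq\right|>1,$$ and for finite $0\le a<b$, $\int_a^b f(x)\,d_{p,q}x=\int_0^b f(x)\,d_{p,q}x-\int_0^a f(x)\,d_{p,q}x$. The improper $(p,q)$-integral on $[0,\infty)$ is $$\int_0^\infty f(x)\,d_{p,q}x=(p-q)\sum_{j=-\infty}^\infty \frac{q^j}{p^{j+1}}f\left(\frac{q^j}{p^{j+1}}\right)\ \text{ if } 0<\frac qp<1,\qquad \int_0^\infty f(x)\,d_{p,q}x=(q-p)\sum_{j=-\infty}^\infty \frac{p^j}{q^{j+1}}f\left(\frac{p^j}{q^{j+1}}\right)\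 \text{ if } \frac qp>1.$$ For $a>0$, $$\int_a^\infty f(x)\,d_{p,q}x=(q-p)a\sum_{k=0}^\infty \frac{p^{-(k+1)}}{q^{-k}}f\left(\frac{p^{-(k+1)}}{q^{-k}}a\right)\ \text{ if } \left|\frac pq\right|<1,\qquad \int_a^\infty f(x)\,d_{p,q}x=(p-q)a\sum_{k=0}^\infty \frac{q^{-(k+1)}}{p^{-k}}f\left(\frac{q^{-(k+1)}}{p^{-k}}a\right)\ \text{ if } \left|\frac pq\right|>1.$$ When $b=\infty$, $F(b)$ denotes $\lim_{x\to\infty}F(x)$.
   Formalization: For b = ∞ the ratio q/p is assumed positive also when a > 0: for a negative ratio the claim fails, e.g. q = 1, p = −1/2, a = 1, F = arctan, where the partial sums F((−2)^N) − F(1) diverge. *)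

(* Defs.v *)
(* Stdlib reals with Coquelicot. *)
From Stdlib Require Import Reals ZArith.
From Coquelicot Require Import Coquelicot.
Open Scope R_scope.

(* [Derive F 0] is a default value when F is not differentiable at 0; whether
   the (p,q)-derivative exists at x is recorded by [ex_pq_derive]. *)
Definition pq_derive (p q : R) (F : R -> R) (x : R) : R :=
  if Req_EM_T x 0 then Derive F 0
  else (F (p * x) - F (q * x)) / ((p - q) * x).

Definition ex_pq_derive (F : R -> R) (x : R) : Prop :=
  x <> 0 \/ ex_derive F 0.

(* The equation D_{p,q} F = f is imposed wherever its left-hand side exists,
   hence not at 0 if F is not differentiable there. *)
Definition is_pq_antiderivative (p q : R) (F f : R -> R) : Prop :=
  forall x : R, ex_pq_derive F x -> pq_derive p q F x = f x.

(* The integrals below are predicates: the series involved converge and the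
   integral has the value [v]. They hold of no [v] outside the ranges of p, q
   for which the integral is defined. *)

Definition is_pq_int_from0 (p q : R) (f : R -> R) (a v : R) : Prop :=
  (Rabs (p / q) < 1 /\
   exists s : R,
     is_series (fun k : nat =>
       p ^ k / q ^ (k + 1) * f (p ^ k / q ^ (k + 1) * a)) s /\
     v = (q - p) * a * s)
  \/
  (Rabs (p / q) > 1 /\
   exists s : R,
     is_series (fun k : nat =>
       q ^ k / p ^ (k + 1) * f (q ^ k / p ^ (k + 1) * a)) s /\
     v = (p - q) * a * s).

(* Bilateral series: the sums over j >= 0 and over j < 0 both converge. *)
Definition is_bilateral_series (u : Z -> R) (s : R) : Prop :=
  exists s1 s2 : R,
    is_series (fun k : nat => u (Z.of_nat k)) s1 /\
    is_series (fun k : nat => u (- (Z.of_nat k + 1))%Z) s2 /\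
    s = s1 + s2.

Definition is_pq_int_0_infty (p q : R) (f : R -> R) (v : R) : Prop :=
  (0 < q / p < 1 /\
   exists s : R,
     is_bilateral_series (fun j : Z =>
       powerRZ q j / powerRZ p (j + 1) *
       f (powerRZ q j / powerRZ p (j + 1))) s /\
     v = (p - q) * s)
  \/
  (q / p > 1 /\
   exists s : R,
     is_bilateral_series (fun j : Z =>
       powerRZ p j / powerRZ q (j + 1) *
       f (powerRZ p j / powerRZ q (j + 1))) s /\
     v = (q - p) * s).

Definition is_pq_int_to_infty (p q : R) (f : R -> R) (a v : R) : Prop :=
  (Rabs (p / q) < 1 /\
   exists s : R,
     is_series (fun k : nat =>
       powerRZ p (- (Z.of_nat k + 1)) / powerRZ q (- Z.of_nat k) *
       f (powerRZ p (- (Z.of_nat k + 1)) / powerRZ q (- Z.of_nat k) * a)) s /\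
     v = (q - p) * a * s)
  \/
  (Rabs (p / q) > 1 /\
   exists s : R,
     is_series (fun k : nat =>
       powerRZ q (- (Z.of_nat k + 1)) / powerRZ p (- Z.of_nat k) *
       f (powerRZ q (- (Z.of_nat k + 1)) / powerRZ p (- Z.of_nat k) * a)) s /\
     v = (p - q) * a * s).

Definition is_pq_int (p q : R) (f : R -> R) (a : R) (b : Rbar) (v : R) : Prop :=
  match b with
  | Finite b' =>
      exists vb va : R,
        is_pq_int_from0 p q f b' vb /\ is_pq_int_from0 p q f a va /\
        v = vb - va
  | p_infty =>
      (a = 0 /\ is_pq_int_0_infty p q f v) \/
      (0 < a /\ is_pq_int_to_infty p q f a v)
  | m_infty => False
  end.

Definition is_value_at (F : R -> R) (b : Rbar) (y : R) : Prop :=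
  match b with
  | Finite b' => y = F b'
  | p_infty => is_lim F p_infty y
  | m_infty => False
  end.

(* The parameters for which the integral up to [b] is defined. The conditions
   q <> 0, p <> 0 make the quotients p / q, q / p meaningful. For b = +oo the
   ratio must be positive: for a negative ratio the nodes of the integral
   from a > 0 tend to infinity with alternating signs, and a limit of F at
   +oo says nothing about its values at the negative ones. *)
Definition pq_admissible (p q : R) (b : Rbar) : Prop :=
  match b with
  | Finite _ => q <> 0 /\ Rabs (p / q) <> 1
  | p_infty => p <> 0 /\ q <> 0 /\ 0 < q / p /\ q / p <> 1
  | m_infty => False
  end.

(* Main.v *)
Require Import Defs.
From Stdlib Require Import Reals ZArith Lra Lia.
From Coquelicot Require Import Coquelicot.
Open Scope R_scope.

(** At a node [x] the summand [(p - q) x f(x)] equals [F(p x) - F(q x)]. The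
    nodes of each integral form a geometric progression of ratio [p/q] or
    [q/p], so each series telescopes along the values of [F] on a geometric
    progression tending to [0], where [F] is continuous, or to [+oo]. *)

Lemma is_series_telescope (G : nat -> R) (l : R) :
  is_lim_seq G l -> is_series (fun k => G (S k) - G k) (l - G 0%nat).
Proof.
  intros HG.
  assert (H : is_lim_seq (sum_n (fun k => G (S k) - G k)) (l - G 0%nat)).
  { apply is_lim_seq_ext with (fun n => G (S n) - G 0%nat).
    - intros n; induction n as [|n IH].
      + now rewrite sum_O.
      + rewrite sum_Sn, <- IH; unfold plus; simpl; ring.
    - apply is_lim_seq_minus'; [now apply (is_lim_seq_incr_1 G)|].
      apply is_lim_seq_const. }
  exact H.
Qed.

(** Exchanging [p] and [q] flips the sign of both numerator and denominator. Since the two branches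
    of each integral are also exchanged by this swap, one branch of each has to be treated. *)
Lemma is_pq_antiderivative_sym (p q : R) (F f : R -> R) :
  p <> q -> is_pq_antiderivative p q F f -> is_pq_antiderivative q p F f.
Proof.
  intros hpq hF x hx; rewrite <- (hF x hx); unfold pq_derive.
  destruct (Req_EM_T x 0) as [_|x0]; [reflexivity|].
  field; repeat split; auto; lra.
Qed.

Lemma pq_antiderivative_node (p q : R) (F f : R -> R) (a t : R) :
  p <> q -> a <> 0 -> is_pq_antiderivative p q F f ->
  t * f (t * a) = / ((p - q) * a) * (F (p * (t * a)) - F (q * (t * a))).
Proof.
  intros hpq ha hF.
  (* A node can be 0, namely when [p = 0] and [k >= 1]. The antiderivative hypothesis may say
     nothing about [f 0], but the weight [t] annihilates it. *)
  destruct (Req_dec t 0) as [->|ht].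
  - rewrite !Rmult_0_l, !Rmult_0_r; ring.
  - assert (hta : t * a <> 0) by now apply Rmult_integral_contrapositive.
    rewrite <- (hF (t * a)) by now left.
    unfold pq_derive; destruct (Req_EM_T (t * a) 0) as [h|_]; [easy|].
    field; repeat split; auto; lra.
Qed.

(** Common core of all the integrals: [t k] is both weight and node, and [G] lists the values of [F]
    along the progression. Multiplication by [q] lands on its [k]-th point and by [p] on the next,
    so the summands telescope up to a constant factor. *)
Lemma is_series_pq_nodes (p q : R) (F f : R -> R) (a : R) (t G : nat -> R)
  (l : R) :
  p <> q -> a <> 0 -> is_pq_antiderivative p q F f ->
  (forall k, F (p * (t k * a)) = G (S k)) ->
  (forall k, F (q * (t k * a)) = G k) ->
  is_lim_seq G l ->
  is_series (fun k => t k * f (t k * a)) (/ ((p - q) * a) * (l - G 0%nat)).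
Proof.
  intros hpq ha hF hp hq hG.
  apply is_series_ext with (fun k => scal (/ ((p - q) * a)) (G (S k) - G k)).
  - intros k; rewrite (pq_antiderivative_node p q F f a (t k) hpq ha hF).
    now rewrite hp, hq.
  - exact (is_series_scal_l (/ ((p - q) * a)) _ _ (is_series_telescope G l hG)).
Qed.

Lemma is_lim_seq_geom_at_0 (F : R -> R) (r a : R) :
  Rabs r < 1 -> continuous F 0 -> is_lim_seq (fun k => F (r ^ k * a)) (F 0).
Proof.
  intros hr hc.
  apply (is_lim_seq_continuous F).
  - now apply continuity_pt_filterlim.
  - replace (Finite 0) with (Rbar_mult 0 a) by (simpl; f_equal; ring).
    apply is_lim_seq_scal_r, is_lim_seq_geom, hr.
Qed.

Lemma is_lim_seq_geom_at_infty (F : R -> R) (r a l : R) :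
  1 < r -> 0 < a -> is_lim F p_infty l ->
  is_lim_seq (fun k => F (r ^ k * a)) l.
Proof.
  intros hr ha hl.
  (* The progression has to avoid the point where the limit is taken; real terms never equal
     [p_infty]. *)
  apply (is_lim_comp_seq F _ p_infty l hl); [now exists 0%nat|].
  replace p_infty with (Rbar_mult p_infty a).
  - apply is_lim_seq_scal_r, is_lim_seq_geom_p, hr.
  - apply is_Rbar_mult_unique; exact (is_Rbar_mult_p_infty_pos a ha).
Qed.

Lemma Rabs_div_swap_lt_1 (p q : R) :
  q <> 0 -> Rabs (p / q) > 1 -> p <> 0 /\ Rabs (q / p) < 1.
Proof.
  intros hq h.
  assert (hp : p <> 0).
  { intros ->; unfold Rdiv in h; rewrite Rmult_0_l, Rabs_R0 in h; lra. }
  split; [exact hp|].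
  replace (q / p) with (/ (p / q)) by now field.
  rewrite Rabs_inv, <- Rinv_1.
  apply Rinv_lt_contravar; lra.
Qed.

Lemma pow_div (x y : R) (n : nat) : (x / y) ^ n = x ^ n / y ^ n.
Proof. unfold Rdiv; now rewrite Rpow_mult_distr, pow_inv. Qed.

Lemma is_series_pq_from0 (p q : R) (F f : R -> R) (a : R) :
  p <> q -> q <> 0 -> Rabs (p / q) < 1 ->
  is_pq_antiderivative p q F f -> continuous F 0 ->
  exists s : R,
    is_series (fun k : nat =>
      p ^ k / q ^ (k + 1) * f (p ^ k / q ^ (k + 1) * a)) s /\
    F a - F 0 = (q - p) * a * s.
Proof.
  intros hpq hq hr hF hc.
  destruct (Req_dec a 0) as [->|ha].
  (* At [a = 0] the integral is 0 through its prefactor, but the series must still converge: it is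
     geometric of ratio [p / q] with first term [f 0 / q]. *)
  - exists (f 0 / q * / (1 - p / q)); split; [|ring].
    apply is_series_ext with (fun k => scal (f 0 / q) ((p / q) ^ k)).
    + intros k; rewrite Rmult_0_r, pow_add, pow_div.
      unfold scal; simpl; unfold mult; simpl.
      field; repeat split; auto using pow_nonzero.
    + exact (is_series_scal_l (f 0 / q) _ _ (is_series_geom _ hr)).
  (* Here [G 0] is [F a] and the limit of [G] is [F 0], which accounts for the change of sign from
     [p - q] to [q - p]. *)
  - exists (/ ((p - q) * a) * (F 0 - F ((p / q) ^ 0 * a))); split.
    + apply (is_series_pq_nodes p q F f a (fun k => p ^ k / q ^ (k + 1))
               (fun k => F ((p / q) ^ k * a))); auto.
      * intros k; f_equal; rewrite pow_add, pow_div; simpl.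
        field; repeat split; auto using pow_nonzero.
      * intros k; f_equal; rewrite pow_add, pow_div; simpl.
        field; repeat split; auto using pow_nonzero.
      * now apply is_lim_seq_geom_at_0.
    + rewrite pow_O, Rmult_1_l; field; split; lra.
Qed.

Lemma is_pq_int_from0_antiderivative (p q : R) (F f : R -> R) (a : R) :
  p <> q -> q <> 0 -> Rabs (p / q) <> 1 ->
  is_pq_antiderivative p q F f -> continuous F 0 ->
  is_pq_int_from0 p q f a (F a - F 0).
Proof.
  intros hpq hq hr hF hc.
  destruct (Rlt_or_le (Rabs (p / q)) 1) as [h|h].
  - left; split; [exact h|]; now apply is_series_pq_from0.
  - assert (h' : Rabs (p / q) > 1) by lra.
    destruct (Rabs_div_swap_lt_1 p q hq h') as [hp hr'].
    right; split; [exact h'|].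
    apply is_series_pq_from0; auto.
    now apply is_pq_antiderivative_sym.
Qed.

Lemma powerRZ_opp_nat (x : R) (k : nat) :
  powerRZ x (- Z.of_nat k) = / x ^ k.
Proof. now rewrite powerRZ_neg', pow_powerRZ. Qed.

Lemma pq_node_neg (p q : R) (k : nat) :
  p <> 0 -> q <> 0 ->
  powerRZ p (- (Z.of_nat k + 1)) / powerRZ q (- Z.of_nat k) = (q / p) ^ k / p.
Proof.
  intros hp hq.
  replace (Z.of_nat k + 1)%Z with (Z.of_nat (S k)) by lia.
  rewrite !powerRZ_opp_nat, pow_div; simpl.
  field; repeat split; auto using pow_nonzero.
Qed.

(** Now the points [(q / p) ^ k * a] grow: [p] sends a node to the [k]-th of them and [q] to the
    next, so the telescoping is applied with [p] and [q] exchanged and runs from [F a] to [l]. *)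
Lemma is_series_pq_to_infty (p q : R) (F f : R -> R) (a l : R) :
  p <> q -> p <> 0 -> q <> 0 -> 1 < q / p -> 0 < a ->
  is_pq_antiderivative p q F f -> is_lim F p_infty l ->
  exists s : R,
    is_series (fun k : nat =>
      powerRZ p (- (Z.of_nat k + 1)) / powerRZ q (- Z.of_nat k) *
      f (powerRZ p (- (Z.of_nat k + 1)) / powerRZ q (- Z.of_nat k) * a)) s /\
    l - F a = (q - p) * a * s.
Proof.
  intros hpq hp hq hr ha hF hl.
  exists (/ ((q - p) * a) * (l - F ((q / p) ^ 0 * a))); split.
  - apply (is_series_pq_nodes q p F f a
      (fun k => powerRZ p (- (Z.of_nat k + 1)) / powerRZ q (- Z.of_nat k))
      (fun k => F ((q / p) ^ k * a))); try lra.
    + now apply is_pq_antiderivative_sym.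
    + intros k; f_equal; rewrite pq_node_neg by auto; simpl; now field.
    + intros k; f_equal; rewrite pq_node_neg by auto; now field.
    + now apply is_lim_seq_geom_at_infty.
  - rewrite pow_O, Rmult_1_l; field; split; lra.
Qed.

(** The bilateral series is cut at the point 1: the terms with [j >= 0] form the integral from 0 to
    1, those with [j < 0] the integral from 1 to infinity, and [F 1] cancels in the sum. *)
Lemma is_bilateral_series_pq (p q : R) (F f : R -> R) (l : R) :
  p <> q -> p <> 0 -> q <> 0 -> 0 < q / p < 1 ->
  is_pq_antiderivative p q F f -> continuous F 0 -> is_lim F p_infty l ->
  exists s : R,
    is_bilateral_series (fun j : Z =>
      powerRZ q j / powerRZ p (j + 1) *
      f (powerRZ q j / powerRZ p (j + 1))) s /\
    l - F 0 = (p - q) * s.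
Proof.
  intros hpq hp hq hr hF hc hl.
  assert (hF' := is_pq_antiderivative_sym p q F f hpq hF).
  assert (hr' : 1 < p / q).
  { replace (p / q) with (/ (q / p)) by now field.
    rewrite <- Rinv_1; apply Rinv_lt_contravar; lra. }
  destruct (is_series_pq_from0 q p F f 1) as [s1 [h1 e1]]; auto.
  { rewrite Rabs_pos_eq; lra. }
  destruct (is_series_pq_to_infty q p F f 1 l) as [s2 [h2 e2]]; auto; try lra.
  exists (s1 + s2); split; [|lra].
  exists s1, s2; repeat split.
  - revert h1; apply is_series_ext; intros k.
    replace (Z.of_nat k + 1)%Z with (Z.of_nat (k + 1)) by lia.
    now rewrite <- !pow_powerRZ, Rmult_1_r.
  - revert h2; apply is_series_ext; intros k.
    replace (- (Z.of_nat k + 1) + 1)%Z with (- Z.of_nat k)%Z by lia.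
    now rewrite Rmult_1_r.
Qed.

Theorem theorem6 (p q : R) (F f : R -> R) (a : R) (b : Rbar) (Fb : R)
  (hpq : p <> q)
  (hadm : pq_admissible p q b)
  (hF : is_pq_antiderivative p q F f)
  (hcont : continuous F 0)
  (ha : 0 <= a)
  (hab : Rbar_lt a b)
  (hFb : is_value_at F b Fb) :
  is_pq_int p q f a b (Fb - F a).
Proof.
  destruct b as [b| |]; simpl in *; [| |easy].
  - destruct hadm as [hq hr].
    (* Both integrals start at 0, so [F 0] cancels in their difference. *)
    exists (F b - F 0), (F a - F 0); subst Fb.
    repeat split; try (now apply is_pq_int_from0_antiderivative); ring.
  - destruct hadm as [hp [hq [hr0 hr1]]].
    assert (hF' := is_pq_antiderivative_sym p q F f hpq hF).
    assert (hinv : p / q = / (q / p)) by now field.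
    assert (hpos : 0 < p / q) by (rewrite hinv; now apply Rinv_0_lt_compat).
    (* The swapped hypothesis [hF'] serves the integral from [a > 0] when [q / p < 1], and the
       bilateral one when [q / p > 1]; the other two cases use [hF] directly. *)
    destruct (Rlt_or_le (q / p) 1) as [h|h].
    + assert (h' : 1 < p / q).
      { rewrite hinv, <- Rinv_1; apply Rinv_lt_contravar; lra. }
      destruct (Rle_lt_or_eq_dec 0 a ha) as [ha'|<-].
      * right; split; [exact ha'|]; right; split.
        -- rewrite Rabs_pos_eq; lra.
        -- apply is_series_pq_to_infty; auto.
      * left; split; [reflexivity|]; left; split; [lra|].
        now apply is_bilateral_series_pq.
    + assert (h' : p / q < 1).
      { rewrite hinv, <- Rinv_1; apply Rinv_lt_contravar; lra. }
      destruct (Rle_lt_or_eq_dec 0 a ha) as [ha'|<-].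
      * right; split; [exact ha'|]; left; split.
        -- rewrite Rabs_pos_eq; lra.
        -- apply is_series_pq_to_infty; auto; lra.
      * left; split; [reflexivity|]; right; split; [lra|].
        apply is_bilateral_series_pq; auto.
Qed.
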